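(* Let $X$ be a set of $\mathcal{L}$-structures and let $p,q$ be prompts on $X$. Assume $\mathsf{Upd}_p(X)$ and $\mathsf{Upd}_{p\oplus q}(X)$ are nonempty. Then the following are equivalent: (i) for all $\mathcal{L}$-sentences $\varphi$, $p\Vdash_X\varphi$ implies $p\oplus q\Vdash_X\varphi$; (ii) $\operatorname{Th}_X(\mathsf{Upd}_p(X))\subseteq\operatorname{Th}_X(\mathsf{Upd}_{p\oplus q}(X))$; (iii) every $\mathcal{L}$-sentence true in all structures of $\mathsf{Upd}_p(X)$ is true in all structures of $\mathsf{Upd}_{p\oplus q}(X)$. If $\mathsf{Upd}_p(X)$ is finite and the language separates points of $X$, then these equivalent conditions imply $\mathsf{Upd}_{p\oplus q}(X)\subseteq\mathsf{Upd}_p(X)$.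
   Context: A prompt specification on $X$ is a pair $p=(H_p,\rho_p)$ with $H_p$ a finite set of $\mathcal{L}$-sentences and $\rho_p:X\to\Gamma_p$ a map into a well-ordered set. $\mathsf{Upd}_p(X):=\operatorname{Min}_{\rho_p}(X\cap\operatorname{Mod}(H_p))$, where $\operatorname{Min}_\rho(A)=\{\mathfrak{M}\in A:\rho(\mathfrak{M})\le\rho(\mathfrak{N})\ \forall\mathfrak{N}\in A\}$. If $\mathsf{Upd}_p(X)\neq\varnothing$, $p\Vdash_X\varphi$ means every $\mathfrak{M}\in\mathsf{Upd}_p(X)$ satisfies $\varphi$. The lexicographic composition is $p\oplus q=(H_p\cup H_q,\rho_{p\oplus q})$ with $\rho_{p\oplus q}(\mathfrak{M})=(\rho_q(\mathfrak{M}),\rho_p(\mathfrak{M}))$ ordered lexicographically. For $S\subseteq X$, $\operatorname{Th}_X(S)$ is the set of $\mathcal{L}$-sentences $\varphi$ with $\mathfrak{M}\models\varphi$ for all $\mathfrak{M}\in S$. The language separates points of $X$ if for any two distinct members of $X$ some $\mathcal{L}$-sentence is true in one and false in the other. *)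

(* Defs.v *)
From mathcomp Require Import all_boot all_order.
From mathcomp Require Import boolp classical_sets functions cardinality wochoice.

Set Implicit Arguments.
Unset Strict Implicit.
Unset Printing Implicit Defensive.

Import Order.TTheory.
Local Open Scope classical_set_scope.

Record language := Language {
  fun_symb : Type;
  fun_ar : fun_symb -> nat;
  rel_symb : Type;
  rel_ar : rel_symb -> nat }.

(* Well-scoped de Bruijn syntax: the free variables of a term or formula of
   index n are among the elements of 'I_n, and a quantifier binds ord0. *)
Inductive term (L : language) (n : nat) : Type :=
| tvar of 'I_n
| tapp (f : fun_symb L) of 'I_(fun_ar f) -> term L n.

Inductive formula (L : language) : nat -> Type :=
| FFalse n : formula L n
| FEq n : term L n -> term L n -> formula L n
| FRel n (r : rel_symb L) : ('I_(rel_ar r) -> term L n) -> formula L n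
| FNot n : formula L n -> formula L n
| FAnd n : formula L n -> formula L n -> formula L n
| FOr n : formula L n -> formula L n -> formula L n
| FImp n : formula L n -> formula L n -> formula L n
| FForall n : formula L n.+1 -> formula L n
| FExists n : formula L n.+1 -> formula L n.

Definition sentence (L : language) := formula L 0.

Record structure (L : language) := Structure {
  carrier :> Type;
  carrier_inhabited : inhabited carrier;
  fun_interp : forall f : fun_symb L, ('I_(fun_ar f) -> carrier) -> carrier;
  rel_interp : forall r : rel_symb L, ('I_(rel_ar r) -> carrier) -> Prop }.

Fixpoint eval (L : language) (M : structure L) n (v : 'I_n -> M)
    (t : term L n) : M :=
  match t with
  | tvar i => v i
  | tapp f ts => fun_interp (fun i => eval v (ts i))
  end.

Definition scons T n (a : T) (v : 'I_n -> T) (i : 'I_n.+1) : T :=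
  if unlift ord0 i is Some j then v j else a.

Fixpoint sat (L : language) (M : structure L) n (phi : formula L n) :
    ('I_n -> M) -> Prop :=
  match phi with
  | FFalse _ => fun=> False
  | FEq _ s t => fun v => eval v s = eval v t
  | FRel _ r ts => fun v => rel_interp (fun i => eval v (ts i))
  | FNot _ a => fun v => ~ sat a v
  | FAnd _ a b => fun v => sat a v /\ sat b v
  | FOr _ a b => fun v => sat a v \/ sat b v
  | FImp _ a b => fun v => sat a v -> sat b v
  | FForall _ a => fun v => forall x : M, sat a (scons x v)
  | FExists _ a => fun v => exists x : M, sat a (scons x v)
  end.

Definition models (L : language) (M : structure L) (phi : sentence L) : Prop :=
  @sat L M 0 phi (ffun0 (card_ord 0)).

Definition Mod (L : language) (H : set (sentence L)) : set (structure L) :=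
  [set M | forall phi, H phi -> models M phi].

Definition Th (L : language) (S : set (structure L)) : set (sentence L) :=
  [set phi | forall M, S M -> models M phi].

Definition separates_points (L : language) (X : set (structure L)) : Prop :=
  forall M N, X M -> X N -> M <> N ->
    exists phi : sentence L,
      (models M phi /\ ~ models N phi) \/ (~ models M phi /\ models N phi).

Definition Min T d (G : porderType d) (rho : T -> G) (A : set T) : set T :=
  [set M | A M /\ forall N, A N -> (rho M <= rho N)%O].

Record prompt (L : language) (X : set (structure L)) := Prompt {
  hyps : set (sentence L);
  hyps_finite : finite_set hyps;
  rank_disp : Order.disp_t;
  rank_type : orderType rank_disp;
  rank_wo : well_order (<=%O : rel rank_type);
  rank : X -> rank_type }.

(* rank is only defined on the subtype of members of X, so the minimum is taken
   there, over the preimage of Mod, and mapped back to structures. *)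
Definition Upd (L : language) (X : set (structure L)) (p : prompt X) :
    set (structure L) :=
  set_val @` Min (@rank L X p) (set_val @^-1` Mod (hyps p)).

(* Forcing is only meaningful when Upd p is nonempty; it is false otherwise. *)
Definition forces (L : language) (X : set (structure L)) (p : prompt X)
    (phi : sentence L) : Prop :=
  Upd p !=set0 /\ forall M, Upd p M -> models M phi.

Lemma lexi_well_order d d' (G : orderType d) (G' : orderType d') :
  well_order (<=%O : rel G) -> well_order (<=%O : rel G') ->
  well_order (<=%O : rel (G *l G')).
Proof.
move=> woG woG'; apply: antisymmetric_well_order; first exact: le_anti.
move=> A [[x0 y0] A0].
have [|x [[Bx xmin] _]] := woG [pred x | `[< exists y, (x, y) \in A >]].
  by exists x0; apply/asboolP; exists y0.
have [|y [[By ymin] _]] := woG' [pred y | (x, y) \in A].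
  by move/asboolP: Bx => [y Axy]; exists y.
exists (x, y); split=> // -[x' y'] Axy'.
rewrite Order.ProdLexiOrder.leEprodlexi /=.
have lexx' : (x <= x')%O by apply: xmin; apply/asboolP; exists y'.
rewrite lexx' /=; apply/implyP => lex'x; apply: ymin.
by rewrite inE (le_anti (x := x) (y := x')) // lexx' lex'x.
Qed.

Lemma finite_hypsU (L : language) (X : set (structure L)) (p q : prompt X) :
  finite_set (hyps p `|` hyps q).
Proof. by rewrite finite_setU; split; exact: hyps_finite. Qed.

Definition compose (L : language) (X : set (structure L)) (p q : prompt X) :
    prompt X :=
  {| hyps := hyps p `|` hyps q;
     hyps_finite := finite_hypsU p q;
     rank_wo := lexi_well_order (@rank_wo L X q) (@rank_wo L X p);
     rank := fun M => (rank q M, rank p M) |}.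

(* Main.v *)
(* If N in Upd(p (+) q) were outside the finite set Upd(p), then the disjunction
   of sentences separating each member of Upd(p) from N would be true throughout
   Upd(p) and false in N. *)

Require Import Defs.
From mathcomp Require Import all_boot all_order.
From mathcomp Require Import boolp classical_sets functions cardinality.

Local Open Scope classical_set_scope.

(** The three conditions unfold to one another, nonemptiness of both update sets supplying the side
    condition in [forces]. For the inclusion, finiteness of [Upd p] lets the separating sentences be
    merged into one first-order sentence, which (i) then carries over to [N], a contradiction. *)

(** Negation lets one choose which of the two structures satisfies the separating sentence. *)
Lemma separates_points_sep (L : language) (X : set (structure L))
    (M N : structure L) :
  separates_points X -> X M -> X N -> M <> N ->
  exists phi : sentence L, models M phi /\ ~ models N phi.
Proof.
move=> sepX XM XN MN; have [phi [?|[nM N_phi]]] := sepX M N XM XN MN.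
  by exists phi.
by exists (FNot phi); split=> // /(_ N_phi).
Qed.

Lemma finite_separating_sentence (L : language) (A : set (structure L))
    (N : structure L) :
  finite_set A ->
  (forall M, A M -> exists phi : sentence L, models M phi /\ ~ models N phi) ->
  exists2 phi : sentence L, Th A phi & ~ models N phi.
Proof.
move=> [n] /pcard_eqP [f] sepA.
(* The disjunction grows along the enumeration [f] of [A]: stage [k] covers the members of index
   below [k], starting from the empty disjunction [FFalse]. *)
suff H k : (k <= n)%N -> exists2 phi : sentence L,
    forall M, A M -> (f M < k)%N -> models M phi & ~ models N phi.
  have [phi phiA phiN] := H n (leqnn n).
  by exists phi => // M AM; apply: phiA => //; have /= := @funS _ _ _ _ f M AM.
elim: k => [_|k IHk kn]; first by exists (FFalse L 0) => // [] [].
have [phi phiA phiN] := IHk (ltnW kn).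
have [M0 AM0 fM0] := @surj _ _ _ _ f k kn.
have [psi [psiM0 psiN]] := sepA M0 AM0.
exists (FOr phi psi) => [M AM|[]//].
rewrite ltnS leq_eqVlt => /orP[/eqP fM|]; last by left; exact: phiA.
(* The new disjunct [psi] need only serve [M0], the unique member of index [k]. *)
right; suff -> : M = M0 by [].
by apply: (@inj _ _ _ f); rewrite ?inE //; exact: etrans fM (esym fM0).
Qed.

Lemma Upd_sub (L : language) (X : set (structure L)) (p : prompt X) :
  Upd p `<=` X.
Proof. by move=> _ [M _ <-]; exact: set_valP. Qed.

Theorem theorem3p9 (L : language) (X : set (structure L)) (p q : prompt X)
    (hp : Upd p !=set0) (hpq : Upd (compose p q) !=set0) :
  [<-> forall phi : sentence L, forces p phi -> forces (compose p q) phi;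
       Th (Upd p) `<=` Th (Upd (compose p q));
       forall phi : sentence L,
         (forall M, Upd p M -> models M phi) ->
         (forall M, Upd (compose p q) M -> models M phi)]
  /\ (finite_set (Upd p) -> separates_points X ->
      (forall phi : sentence L, forces p phi -> forces (compose p q) phi) ->
      Upd (compose p q) `<=` Upd p).
Proof.
split.
  tfae=> [H phi phiU|//|H phi [_ phiU]]; last by split=> //; exact: H.
  by have [] := H phi (conj hp phiU).
move=> finU sepX H N UN; apply: contrapT => nUN.
have [M UM|phi phiU] := @finite_separating_sentence L (Upd p) N finU.
  apply: (@separates_points_sep L X) => //; [exact: Upd_sub UM|exact: Upd_sub UN|].
  by move=> MN; apply: nUN; rewrite -MN.
(* [p] forces [phi], so the composition does too, and [N] would satisfy it. *)
by apply; have [_] := H phi (conj hp phiU); apply.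
Qed.
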